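(* Let $i\in[1,k]$. Suppose that $K=K_i$ and that $v(x_i)=v(g)+t$. Then the reduction $V_i/\pi V_i$ is a simple $\bar T\wr G$-module.
   Context: A finite group $G$ acts (from the right, $y\mapsto y^\sigma$, by field automorphisms, not necessarily faithfully) on a field $L$ with fixed field $K$. Let $N$ be the kernel of this operation, $g=|G|$, $h=[L:K]$, $n=|N|$, so $g=hn$. Assume that $n$ is invertible in $K$. The twisted group ring $L\wr G$ is the $K$-algebra which as a right $L$-vector space has basis $G$, with multiplication determined by $(\sigma y)(\tau z)=(\sigma\tau)(y^\tau z)$ for $\sigma,\tau\in G$, $y,z\in L$. It is semisimple. Let $X_1,\dots,X_k$ be representatives of the isomorphism classes of simple right $L\wr G$-modules, where $X_1=L$ with operation $y\cdot(\sigma z)=y^\sigma z$. Let $K_i=\operatorname{End}_{L\wr G}X_i$ (a skew field containing $K$), and let $x_i$ be the dimension of $X_i$ as a left module over $K_i$. Let $S\subset K$ be a discrete valuation ring with field of fractions $K$, maximal ideal generated by $\pi$, and residue field $\bar S=S/\pi S$. The $\pi$-adic valuation of an element $y\in K$ is denoted by $v(y)$. Let $T$ be the integral closure of $S$ in $L$, and $\bar T=T/\pi T$. The twisted group rings $T\wr G\subset L\wr G$ and $\bar T\wr G=(T\wr G)/\pi(T\wr G)$ are defined with the same multiplication rule. For each $i\in[1,k]$, $V_i\subset X_i$ is a chosen finitely generated $T\wr G$-submodule with $KV_i=X_i$ and such that $S_i=\operatorname{End}_{T\wr G}V_i$ is a maximal order in $K_i$; in particular, $V_1=T\subset L=X_1$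 is chosen. Let $(y_l)_{l\in[1,h]}$ be an $S$-linear basis of $T$ and $(y_l^\ast)_{l\in[1,h]}$ the $K$-basis of $L$ dual to it with respect to $\operatorname{Tr}_{L/K}$, i.e. $\operatorname{Tr}_{L/K}(y_ly_m^\ast)=1$ if $l=m$ and $=0$ if $l\neq m$. The integer $t\ge 0$ is defined by $S\pi^t=\{z\in S\mid zy_l^\ast\in T\text{ for all }l\in[1,h]\}$; that is, $t$ is the maximal elementary divisor exponent of the Gram matrix of the trace bilinear form on $T$ induced by $\operatorname{Tr}_{L/K}$.
   Formalization: The formal statement assumes in addition that g is nonzero in K, so that v(x_i)=v(g)+t is an equation of integers; read as ∞=∞+t the claim fails (char K=p, L/K totally wildly ramified of degree p, V_1=T). *)

(* Defs.v *)
From HB Require Import structures.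
From mathcomp Require Import all_boot all_order all_algebra all_fingroup all_field.
From mathcomp Require Import generic_quotient ring_quotient.
From mathcomp Require Import boolp classical_sets constructive_ereal.

Set Implicit Arguments.
Unset Strict Implicit.
Unset Printing Implicit Defensive.

Import GRing.Theory.
Local Open Scope ring_scope.
Local Open Scope quotient_scope.

(* Right R-modules are left modules over the converse ring R^c: the module
   element "v times a" is written [a *: v]. *)
Notation rmodType R := (lmodType R^c).

Definition simple_module (R : pzRingType) (M : lmodType R) : Prop :=
  (exists m : M, m <> 0) /\
  forall U : submodClosed M,
    (forall m, m \in U -> m = 0) \/ (forall m, m \in U).

Definition module_iso (R : pzRingType) (M M' : lmodType R) : Prop :=
  exists f : {linear M -> M'}, bijective f.

Definition finitely_generated (R : pzRingType) (M : lmodType R) : Prop :=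
  exists m (e : 'I_m -> M), forall v : M,
    exists a : 'I_m -> R, v = \sum_(i < m) a i *: e i.

(* [d] is the dimension of M as a left module over the ring End_R(M). *)
Definition dim_over_End (R : pzRingType) (M : lmodType R) (d : nat) : Prop :=
  exists b : 'I_d -> M,
    (forall v : M, exists f : 'I_d -> {linear M -> M},
        v = \sum_(i < d) f i (b i)) /\
    (forall f : 'I_d -> {linear M -> M},
        \sum_(i < d) f i (b i) = 0 -> forall i v, f i v = 0).

Section Restriction.
Variables (R R' : pzRingType) (f : {rmorphism R -> R'}) (M : rmodType R').

Definition restr : Type := let _ := f in M.
HB.instance Definition _ := GRing.Zmodule.on restr.

Definition restr_scale (a : R^c) (v : restr) : restr := (f a : R'^c) *: (v : M).

Fact restr_scaleA a b v :
  restr_scale a (restr_scale b v) = restr_scale (a * b) v.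
Proof.
by rewrite /restr_scale scalerA; congr (_ *: _); rewrite -[LHS]rmorphM.
Qed.
Fact restr_scale1 : left_id 1 restr_scale.
Proof. by move=> v; rewrite /restr_scale rmorph1 scale1r. Qed.
Fact restr_scaleDr : right_distributive restr_scale +%R.
Proof. by move=> a u v; rewrite /restr_scale scalerDr. Qed.
Fact restr_scaleDl v : {morph restr_scale^~ v : a b / a + b}.
Proof. by move=> a b; rewrite /restr_scale rmorphD scalerDl. Qed.
HB.instance Definition _ := GRing.Zmodule_isLmodule.Build R^c restr
  restr_scaleA restr_scale1 restr_scaleDr restr_scaleDl.
End Restriction.

Section Submodule.
Variables (R : pzRingType) (M : lmodType R) (V : submodClosed M).

Definition submodule : Type := {v : M | v \in V}.
HB.instance Definition _ := SubChoice.on submodule.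
HB.instance Definition _ := [SubChoice_isSubLmodule of submodule by <:].
End Submodule.

Record ringAction (gT : finGroupType) (B : pzRingType) := RingAction {
  ract :> {action gT &-> B};
  ractD : forall s, {morph ract^~ s : x y / x + y};
  ractM : forall s, {morph ract^~ s : x y / x * y};
  ract1 : forall s, ract 1 s = 1
}.

Section ActionTheory.
Variables (gT : finGroupType) (B : pzRingType) (act : ringAction gT B).

Lemma act_id x : act x 1%g = x.
Proof.
have [inj hM] : is_action [set: gT] act by case: (ract act).
by apply: (inj 1%g); rewrite -hM ?inE // mulg1.
Qed.
Lemma act_mul x s t : act x (s * t)%g = act (act x s) t.
Proof.
have [_ hM] : is_action [set: gT] act by case: (ract act).
by rewrite hM ?inE.
Qed.
Lemma act0 s : act 0 s = 0.
Proof. by apply: (addrI (act 0 s)); rewrite -ractD !addr0. Qed.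
Lemma act_sum I r (P : pred I) (F : I -> B) s :
  act (\sum_(i <- r | P i) F i) s = \sum_(i <- r | P i) act (F i) s.
Proof. exact: (big_morph (act^~ s) (ractD act s) (act0 s)). Qed.
Lemma actB x y s : act (x - y) s = act x s - act y s.
Proof. by apply/eqP; rewrite eq_sym subr_eq -ractD subrK. Qed.
End ActionTheory.

Definition act_kernel (gT : finGroupType) (B : pzRingType)
  (act : ringAction gT B) : {set gT} := [set s | `[< forall y, act y s = y >]].

Section TwistedGroupRing.
Variables (gT : finGroupType) (B : comPzRingType) (act : ringAction gT B).

(* The phantom [let _ := act] makes the ring structure depend on the action.
   The function [a] stands for the sum over s of s * a(s), coefficients on the
   right. *)
Definition twg : Type := let _ := act in {ffun gT -> B}.
HB.instance Definition _ := GRing.Zmodule.on twg.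

Definition tcoef (a : twg) (s : gT) : B := (a : {ffun gT -> B}) s.
Definition mk_twg (f : gT -> B) : twg := [ffun s => f s].

Lemma tcoef_mk f s : tcoef (mk_twg f) s = f s.
Proof. by rewrite /tcoef ffunE. Qed.
Lemma tcoefD a b s : tcoef (a + b) s = tcoef a s + tcoef b s.
Proof. by rewrite /tcoef ffunE. Qed.
Lemma tcoefB a b s : tcoef (a - b) s = tcoef a s - tcoef b s.
Proof. by apply/eqP; rewrite eq_sym subr_eq -tcoefD subrK. Qed.
Lemma tcoef_sum I r (P : pred I) (F : I -> twg) s :
  tcoef (\sum_(i <- r | P i) F i) s = \sum_(i <- r | P i) tcoef (F i) s.
Proof.
by apply: (big_morph (tcoef^~ s) (fun a b => tcoefD a b s)); rewrite /tcoef ffunE.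
Qed.
Lemma twgP (a b : twg) : tcoef a =1 tcoef b -> a = b.
Proof. by move=> h; apply/ffunP. Qed.

Definition twg_mono (s : gT) (y : B) : twg := mk_twg (fun t => if t == s then y else 0).
Lemma tcoef_mono s y t : tcoef (twg_mono s y) t = if t == s then y else 0.
Proof. exact: tcoef_mk. Qed.
Definition twg_mul (a b : twg) : twg :=
  mk_twg (fun r => \sum_s act (tcoef a s) (s^-1 * r)%g * tcoef b (s^-1 * r)%g).

Fact twg_mulA : associative twg_mul.
Proof.
move=> a b c; apply: twgP => r; rewrite !tcoef_mk.
under [RHS]eq_bigr => s _.
  rewrite tcoef_mk act_sum mulr_suml.
  under eq_bigr => t _ do rewrite ractM -act_mul -!mulrA.
over.
rewrite exchange_big /=; apply: eq_bigr => t _.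
rewrite tcoef_mk mulr_sumr.
rewrite [RHS](reindex_inj (mulgI t)) /=; apply: eq_bigr => s _.
by rewrite invMg !mulgA mulVg mul1g mulgV mul1g.
Qed.

Fact twg_mul1 : left_id (twg_mono 1%g 1) twg_mul.
Proof.
move=> a; apply: twgP => r; rewrite tcoef_mk (bigD1 1%g) //= big1 => [|s /negbTE ns].
  by rewrite tcoef_mk eqxx ract1 mul1r addr0 invg1 mul1g.
by rewrite tcoef_mk ns act0 mul0r.
Qed.

Fact twg_1mul : right_id (twg_mono 1%g 1) twg_mul.
Proof.
move=> a; apply: twgP => r; rewrite tcoef_mk (bigD1 r) //= big1 => [|s /negbTE ns].
  by rewrite tcoef_mk mulVg eqxx act_id mulr1 addr0.
by rewrite tcoef_mk -eq_mulVg1 ns mulr0.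
Qed.

Fact twg_mulDl : left_distributive twg_mul +%R.
Proof.
move=> a b c; apply: twgP => r; rewrite tcoefD !tcoef_mk -big_split.
by apply: eq_bigr => s _; rewrite tcoefD ractD mulrDl.
Qed.

Fact twg_mulDr : right_distributive twg_mul +%R.
Proof.
move=> a b c; apply: twgP => r; rewrite tcoefD !tcoef_mk -big_split.
by apply: eq_bigr => s _; rewrite tcoefD mulrDr.
Qed.

HB.instance Definition _ := GRing.Zmodule_isPzRing.Build twg
  twg_mulA twg_mul1 twg_1mul twg_mulDl twg_mulDr.

Lemma tcoefM (a b : twg) r :
  tcoef (a * b) r = \sum_s act (tcoef a s) (s^-1 * r)%g * tcoef b (s^-1 * r)%g.
Proof. exact: tcoef_mk. Qed.

Lemma tcoef1 r : tcoef 1 r = (r == 1%g)%:R.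
Proof. by rewrite tcoef_mk; case: eqP. Qed.

Lemma twg_monoM s t y z :
  twg_mono s y * twg_mono t z = twg_mono (s * t)%g (act y t * z).
Proof.
apply: twgP => r; rewrite tcoefM (bigD1 s) //= big1 => [|u /negbTE nu].
  rewrite !tcoef_mk eqxx addr0 -(inj_eq (mulgI s)) mulKVg.
  by case: eqP => [->|_]; rewrite ?mulr0 ?mulKg.
by rewrite !tcoef_mk nu act0 mul0r.
Qed.

Lemma twg_monoE (a : twg) : a = \sum_s twg_mono s (tcoef a s).
Proof.
apply: twgP => r; rewrite tcoef_sum (bigD1 r) //= big1 ?tcoef_mk ?eqxx ?addr0 //.
by move=> s /negbTE ns; rewrite tcoef_mk eq_sym ns.
Qed.

(* B itself, with y . (s z) = y^s z *)
Definition natural_module : Type := let _ := act in B.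
HB.instance Definition _ := GRing.Zmodule.on natural_module.
Definition natural_scale (a : twg^c) (y : natural_module) : natural_module :=
  \sum_s act (y : B) s * tcoef a s.

Fact natural_scaleA a b v :
  natural_scale a (natural_scale b v) = natural_scale (a * b) v.
Proof.
rewrite /natural_scale.
under eq_bigr => s _.
  rewrite act_sum mulr_suml.
  under eq_bigr => t _ do rewrite ractM -act_mul -mulrA.
over.
under [RHS]eq_bigr => r _ do rewrite (tcoefM b a) mulr_sumr.
rewrite exchange_big [RHS]exchange_big /=; apply: eq_bigr => t _.
rewrite [RHS](reindex_inj (mulgI t)) /=; apply: eq_bigr => s _.
by rewrite mulKg.
Qed.
Fact natural_scale1 : left_id 1 natural_scale.
Proof.
move=> v; rewrite /natural_scale (bigD1 1%g) //= big1 => [|s /negbTE ns].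
  by rewrite tcoef1 eqxx mulr1 addr0 act_id.
by rewrite tcoef1 ns mulr0.
Qed.
Fact natural_scaleDr : right_distributive natural_scale +%R.
Proof.
move=> a u v; rewrite /natural_scale -big_split; apply: eq_bigr => s _.
by rewrite ractD mulrDl.
Qed.
Fact natural_scaleDl v : {morph natural_scale^~ v : a b / a + b}.
Proof.
move=> a b; rewrite /natural_scale -big_split; apply: eq_bigr => s _.
by rewrite tcoefD mulrDr.
Qed.
HB.instance Definition _ := GRing.Zmodule_isLmodule.Build twg^c natural_module
  natural_scaleA natural_scale1 natural_scaleDr natural_scaleDl.
End TwistedGroupRing.

Section TwistedGroupRingMap.
Variables (gT : finGroupType) (B B' : comPzRingType).
Variables (act : ringAction gT B) (act' : ringAction gT B').
Variables (f : {rmorphism B -> B'}) (fE : forall x s, f (act x s) = act' (f x) s).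

Definition twg_map (a : twg act) : twg act' :=
  let _ := fE in mk_twg act' (fun s => f (tcoef a s)).

Lemma tcoef_map a s : tcoef (twg_map a) s = f (tcoef a s).
Proof. exact: tcoef_mk. Qed.
Fact twg_map_zmod : zmod_morphism twg_map.
Proof.
move=> a b; apply: twgP => s.
by rewrite [RHS]tcoefB !tcoef_map tcoefB rmorphB.
Qed.
Fact twg_map_monoid : monoid_morphism twg_map.
Proof.
split=> [|a b]; apply: twgP => s.
  by rewrite tcoef_map !tcoef1 rmorph_nat.
rewrite tcoef_map !tcoefM rmorph_sum; apply: eq_bigr => t _.
by rewrite rmorphM fE !tcoef_map.
Qed.
HB.instance Definition _ := GRing.isZmodMorphism.Build _ _ twg_map twg_map_zmod.
HB.instance Definition _ := GRing.isMonoidMorphism.Build _ _ twg_map twg_map_monoid.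
End TwistedGroupRingMap.

Section PrincipalQuotient.
Variables (B : comPzRingType) (p : B).

Definition principal : {pred B} := [pred x | `[< exists y, x = p * y >]].
Fact principal_zmod_closed : zmod_closed principal.
Proof.
split=> [|x y /asboolP[x' ->] /asboolP[y' ->]]; apply/asboolP.
  by exists 0; rewrite mulr0.
by exists (x' - y'); rewrite mulrBr.
Qed.
HB.instance Definition _ := GRing.isZmodClosed.Build B principal principal_zmod_closed.

(* B/pB; the library's ideal quotients require the ideal to be proper. *)
Definition pquot : Type := Quotient.quot principal.
HB.instance Definition _ := GRing.Zmodule.on pquot.
Definition pproj (x : B) : pquot := \pi_(Quotient.quot principal) x.
Definition prepr (x : pquot) : B := repr (x : Quotient.quot principal).

Lemma pprojP x y : pproj x = pproj y <-> exists z, x - y = p * z.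
Proof.
split=> [/eqP|h]; first by rewrite -Quotient.idealrBE => /asboolP.
by apply/eqP; rewrite -Quotient.idealrBE; apply/asboolP.
Qed.
Lemma preprK : cancel prepr pproj.
Proof. by move=> x; rewrite /pproj reprK. Qed.
Lemma prepr_pproj x : exists z, prepr (pproj x) - x = p * z.
Proof. by apply/pprojP; rewrite preprK. Qed.
Fact pproj_zmod : zmod_morphism pproj.
Proof. by move=> x y; rewrite /pproj !piE. Qed.
HB.instance Definition _ := GRing.isZmodMorphism.Build B pquot pproj pproj_zmod.

Definition pquot_one : pquot := pproj 1.
Definition pquot_mul (x y : pquot) : pquot := pproj (prepr x * prepr y).

Lemma pquot_mulE x y : pquot_mul (pproj x) (pproj y) = pproj (x * y).
Proof.
apply/pprojP; have [u eu] := prepr_pproj x; have [v ev] := prepr_pproj y.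
exists (u * prepr (pproj y) + x * v).
rewrite mulrDr mulrA -eu mulrCA -ev mulrBl mulrBr.
by rewrite addrA subrK.
Qed.
Fact pquot_mulA : associative pquot_mul.
Proof.
by move=> x y z; rewrite -[x]preprK -[y]preprK -[z]preprK !pquot_mulE mulrA.
Qed.
Fact pquot_mulC : commutative pquot_mul.
Proof. by move=> x y; rewrite -[x]preprK -[y]preprK !pquot_mulE mulrC. Qed.
Fact pquot_mul1 : left_id pquot_one pquot_mul.
Proof. by move=> x; rewrite -[x]preprK pquot_mulE mul1r. Qed.
Fact pquot_mulDl : left_distributive pquot_mul +%R.
Proof.
move=> x y z; rewrite -[x]preprK -[y]preprK -[z]preprK.
by rewrite -raddfD !pquot_mulE mulrDl raddfD.
Qed.
HB.instance Definition _ := GRing.Zmodule_isComPzRing.Build pquot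
  pquot_mulA pquot_mulC pquot_mul1 pquot_mulDl.
Fact pproj_monoid : monoid_morphism pproj.
Proof. by split=> // x y; rewrite -pquot_mulE. Qed.
HB.instance Definition _ := GRing.isMonoidMorphism.Build B pquot pproj pproj_monoid.
End PrincipalQuotient.

Section Reduction.
Variables (gT : finGroupType) (B : comPzRingType) (act : ringAction gT B).
Variables (p : B) (pG : forall s, act p s = p).

Definition pact_fun (x : pquot p) (s : gT) : pquot p := let _ := pG in pproj p (act (prepr x) s).

Lemma pact_funE x s : pact_fun (pproj p x) s = pproj p (act x s).
Proof.
apply/pprojP; have [z ez] := prepr_pproj p x; exists (act z s).
by rewrite -actB ez ractM pG.
Qed.
Fact pact_fun1 : pact_fun^~ 1%g =1 id.
Proof. by move=> x; rewrite -[x]preprK pact_funE act_id. Qed.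
Fact pact_funM x : act_morph pact_fun x.
Proof. by move=> s t; rewrite -[x]preprK !pact_funE act_mul. Qed.
Fact pactD s : {morph TotalAction pact_fun1 pact_funM ^~ s : x y / x + y}.
Proof.
move=> x y /=; rewrite -[x]preprK -[y]preprK -raddfD !pact_funE.
by rewrite ractD raddfD.
Qed.
Fact pactM s : {morph TotalAction pact_fun1 pact_funM ^~ s : x y / x * y}.
Proof.
move=> x y /=; rewrite -[x]preprK -[y]preprK -rmorphM !pact_funE.
by rewrite ractM rmorphM.
Qed.
Fact pact1 s : TotalAction pact_fun1 pact_funM 1 s = 1.
Proof. by rewrite -[1](rmorph1 (pproj p)) /= pact_funE ract1. Qed.
Definition pact : ringAction gT (pquot p) := RingAction pactD pactM pact1.

Variable V : rmodType (twg act).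

Definition pmul (v : V) : V := (twg_mono act 1%g p : (twg act)^c) *: v.

Lemma pmul_central (a : twg act) :
  twg_mono act 1%g p * a = a * twg_mono act 1%g p.
Proof.
rewrite [a]twg_monoE mulr_sumr mulr_suml; apply: eq_bigr => s _.
by rewrite !twg_monoM pG mul1g mulg1 act_id mulrC.
Qed.
Lemma pmulZ (a : (twg act)^c) v : a *: pmul v = pmul (a *: v).
Proof. by rewrite /pmul !scalerA; congr (_ *: _); apply: pmul_central. Qed.

Definition pV : {pred V} := let _ := pG in [pred v | `[< exists w, v = pmul w >]].
Fact pV_zmod_closed : zmod_closed pV.
Proof.
split=> [|x y /asboolP[x' ->] /asboolP[y' ->]]; apply/asboolP.
  by exists 0; rewrite /pmul scaler0.
by exists (x' - y'); rewrite /pmul scalerBr.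
Qed.
HB.instance Definition _ := GRing.isZmodClosed.Build V pV pV_zmod_closed.

(* V/pV as a module over the twisted group ring of B/pB *)
Definition reduction : Type := Quotient.quot pV.
HB.instance Definition _ := GRing.Zmodule.on reduction.
Definition rproj (v : V) : reduction := \pi_(Quotient.quot pV) v.
Definition rrepr (v : reduction) : V := repr (v : Quotient.quot pV).

Lemma rprojP x y : rproj x = rproj y <-> exists z, x - y = pmul z.
Proof.
split=> [/eqP|h]; first by rewrite -Quotient.idealrBE => /asboolP.
by apply/eqP; rewrite -Quotient.idealrBE; apply/asboolP.
Qed.
Lemma rreprK : cancel rrepr rproj.
Proof. by move=> x; rewrite /rproj reprK. Qed.
Fact rproj_zmod : zmod_morphism rproj.
Proof. by move=> x y; rewrite /rproj !piE. Qed.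
HB.instance Definition _ := GRing.isZmodMorphism.Build V reduction rproj rproj_zmod.

Fact pprojG x s : pproj p (act x s) = pact (pproj p x) s.
Proof. by rewrite /= pact_funE. Qed.
Definition twg_red : twg act -> twg pact := twg_map pprojG.
HB.instance Definition _ := GRing.RMorphism.on twg_red.
Definition twg_lift (a : twg pact) : twg act := mk_twg act (fun s => prepr (tcoef a s)).

Lemma twg_liftK : cancel twg_lift twg_red.
Proof. by move=> a; apply: twgP => s; rewrite tcoef_map tcoef_mk; exact: preprK. Qed.
Lemma twg_redP a b : twg_red a = twg_red b -> exists c, a - b = twg_mono act 1%g p * c.
Proof.
move=> e; have h s : exists z, tcoef a s - tcoef b s = p * z.
  by apply/pprojP; have := congr1 (fun c => tcoef c s) e; rewrite !tcoef_map.
have [c hc] := choice h; exists (mk_twg act c); apply: twgP => s.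
rewrite tcoefM (bigD1 1%g) //= big1 => [|t /negbTE nt]; last first.
  by rewrite tcoef_mono nt act0 mul0r.
by rewrite tcoef_mono tcoef_mk eqxx pG invg1 mul1g addr0 tcoefB hc.
Qed.

Definition red_scale (a : (twg pact)^c) (v : reduction) : reduction :=
  rproj ((twg_lift a : (twg act)^c) *: rrepr v).

Lemma red_scaleE (a : twg act) v :
  red_scale (twg_red a) (rproj v) = rproj ((a : (twg act)^c) *: v).
Proof.
apply/rprojP.
have [c hc] : exists c, twg_lift (twg_red a) - a = twg_mono act 1%g p * c.
  by apply: twg_redP; rewrite twg_liftK.
have [w hw] : exists w, rrepr (rproj v) - v = pmul w by apply/rprojP; rewrite rreprK.
exists ((twg_lift (twg_red a) : (twg act)^c) *: w + (c : (twg act)^c) *: v).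
have -> : pmul ((twg_lift (twg_red a) : (twg act)^c) *: w + (c : (twg act)^c) *: v)
    = (twg_lift (twg_red a) : (twg act)^c) *: pmul w + (c : (twg act)^c) *: pmul v.
  by rewrite !pmulZ /pmul scalerDr.
have -> : (c : (twg act)^c) *: pmul v = (twg_lift (twg_red a) - a : (twg act)^c) *: v.
  by rewrite hc /pmul scalerA.
by rewrite -hw scalerBr scalerBl addrA subrK.
Qed.

Fact red_scaleA a b v : red_scale a (red_scale b v) = red_scale (a * b) v.
Proof.
rewrite -[v]rreprK -[a]twg_liftK -[b]twg_liftK !red_scaleE scalerA.
by rewrite -red_scaleE; congr red_scale; apply: (rmorphM twg_red).
Qed.
Fact red_scale1 : left_id 1 red_scale.
Proof.
by move=> v; rewrite -[v]rreprK -[1](rmorph1 twg_red) red_scaleE scale1r.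
Qed.
Fact red_scaleDr : right_distributive red_scale +%R.
Proof.
move=> a u v; rewrite -[u]rreprK -[v]rreprK -[a]twg_liftK -raddfD !red_scaleE.
by rewrite scalerDr raddfD.
Qed.
Fact red_scaleDl v : {morph red_scale^~ v : a b / a + b}.
Proof.
move=> a b; rewrite -[v]rreprK -[a]twg_liftK -[b]twg_liftK.
by rewrite -(raddfD twg_red) !red_scaleE scalerDl raddfD.
Qed.
HB.instance Definition _ := GRing.Zmodule_isLmodule.Build (twg pact)^c reduction
  red_scaleA red_scale1 red_scaleDr red_scaleDl.
End Reduction.

Section Subring.
Variables (K : fieldType) (S : subringClosed K).
Definition sring : Type := {x : K | x \in S}.
HB.instance Definition _ := SubChoice.on sring.
HB.instance Definition _ := [SubChoice_isSubComNzRing of sring by <:].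

Variable pi : sring.

(* S is a discrete valuation ring with field of fractions K: a principal ideal
   domain whose non-units form the nonzero ideal generated by pi. *)
Definition is_dvr : Prop :=
  [/\ forall x : K, exists a b : sring, val b != 0 /\ x = val a / val b,
      forall I : sring -> Prop, I 0 -> (forall a b, I a -> I b -> I (a + b)) ->
        (forall a b, I b -> I (a * b)) ->
        exists c, forall a, I a <-> exists b, a = b * c,
      pi != 0
    & forall a : sring, (~ exists b, a * b = 1) <-> exists b, a = pi * b].

(* The pi-adic valuation, with value +oo at 0; for nonzero y it is the unique m
   such that y is a unit of S times pi^m. *)
Definition valuation (y : K) : \bar int :=
  if y == 0 then +oo%E
  else (xget (0 : int) [set m : int | exists u u' : sring,
          u * u' = 1 /\ y = val u * val pi ^ m])%:E.
End Subring.

Section IntegralClosure.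
Variables (K : fieldType) (L : fieldExtType K) (S : subringClosed K).

Definition sring_in (s : sring S) : L := (val s)%:A.
Fact sring_in_zmod : zmod_morphism sring_in.
Proof. by move=> x y; rewrite /sring_in rmorphB scalerBl. Qed.
Fact sring_in_monoid : monoid_morphism sring_in.
Proof.
split=> [|x y]; first by rewrite /sring_in rmorph1 scale1r.
by rewrite /sring_in rmorphM -scalerA mulr_algl.
Qed.
HB.instance Definition _ := GRing.isZmodMorphism.Build _ _ sring_in sring_in_zmod.
HB.instance Definition _ := GRing.isMonoidMorphism.Build _ _ sring_in sring_in_monoid.

Definition intclos : {pred L} := [pred x | `[< integralOver sring_in x >]].
Fact intclos_subring : subring_closed intclos.
Proof.
split=> [|x y /asboolP hx /asboolP hy|x y /asboolP hx /asboolP hy]; apply/asboolP.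
- exact: integral1.
- exact: integral_sub.
- exact: integral_mul.
Qed.
HB.instance Definition _ := GRing.isSubringClosed.Build L intclos intclos_subring.

Definition tring : Type := {x : L | x \in intclos}.
HB.instance Definition _ := SubChoice.on tring.
HB.instance Definition _ := [SubChoice_isSubComNzRing of tring by <:].

Fact sring_intclos (s : sring S) : sring_in s \in intclos.
Proof. by apply/asboolP; apply: integral_id. Qed.
Definition sring_tring (s : sring S) : tring := Sub (sring_in s) (sring_intclos s).
End IntegralClosure.
Arguments sring_in {K} L S s.
Arguments intclos {K} L S _.
Arguments tring {K} L S.
Arguments sring_tring {K} L {S} s.

(* An action of gT on L by field automorphisms with fixed field K; that L is
   finite over K is then automatic by Artin's theorem. *)
Record galoisAction (gT : finGroupType) (K : fieldType) (L : fieldExtType K) :=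
  GaloisAction {
    gact :> ringAction gT L;
    gact_fixed : forall y, (forall s, gact y s = y) <-> y \in 1%VS
  }.

Section Lattices.
Variables (gT : finGroupType) (K : fieldType) (L : fieldExtType K).
Variables (act : galoisAction gT L) (S : subringClosed K).

Lemma gact_alg (c : K) s : act c%:A s = c%:A.
Proof. by have [_ h] := gact_fixed act c%:A; apply: h; rewrite rpredZ // mem1v. Qed.

Lemma intclosG x s : x \in intclos L S -> act x s \in intclos L S.
Proof.
move=> /asboolP[q mq /eqP rq]; apply/asboolP; exists q => //; apply/eqP.
transitivity (act (map_poly (sring_in L S) q).[x] s); last by rewrite rq act0.
rewrite !horner_coef act_sum; apply: eq_bigr => i _.
rewrite ractM coef_map /= gact_alg; congr (_ * _).
by elim: {+}(nat_of_ord i) => [|n ihn]; rewrite ?expr0 ?ract1 // !exprS ractM ihn.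
Qed.

Definition tact_fun (x : tring L S) (s : gT) : tring L S :=
  Sub (act (val x) s) (intclosG s (valP x)).
Fact tact_fun1 : tact_fun^~ 1%g =1 id.
Proof. by move=> x; apply: val_inj; rewrite SubK act_id. Qed.
Fact tact_funM x : act_morph tact_fun x.
Proof. by move=> s t; apply: val_inj; rewrite !SubK act_mul. Qed.
Fact tactD s : {morph TotalAction tact_fun1 tact_funM ^~ s : x y / x + y}.
Proof. by move=> x y; apply: val_inj; rewrite /= ractD. Qed.
Fact tactM s : {morph TotalAction tact_fun1 tact_funM ^~ s : x y / x * y}.
Proof. by move=> x y; apply: val_inj; rewrite /= ractM. Qed.
Fact tact1 s : TotalAction tact_fun1 tact_funM 1 s = 1.
Proof. by apply: val_inj; rewrite /= ract1. Qed.
Definition tact : ringAction gT (tring L S) := RingAction tactD tactM tact1.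

Notation LG := (twg act).
Notation TG := (twg tact).

Fact valG (x : tring L S) s : val (tact x s) = act (val x) s.
Proof. by []. Qed.
Definition TG_incl : TG -> LG := twg_map (f := val) valG.
HB.instance Definition _ := GRing.RMorphism.on TG_incl.

Fact sring_fixed (c : sring S) s : tact (sring_tring L c) s = sring_tring L c.
Proof. by apply: val_inj; rewrite /= /sring_in gact_alg. Qed.

Section Module.
Variable X : rmodType LG.

Definition Kmul (c : K) (v : X) : X := (twg_mono act 1%g c%:A : LG^c) *: v.

(* the canonical map from K to End(X) is onto *)
Definition End_is_K : Prop :=
  forall f : {linear X -> X}, exists c : K, f =1 Kmul c.

(* S-orders in the K-algebra End(X): subrings, finitely generated as S-modules,
   that span End(X) over K. *)
Definition is_order (O : {linear X -> X} -> Prop) : Prop :=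
  [/\ forall f : {linear X -> X}, f =1 id -> O f,
      forall f g h : {linear X -> X}, O f -> O g -> h =1 f \- g -> O h,
      forall f g h : {linear X -> X}, O f -> O g -> h =1 f \o g -> O h,
      exists m (e : 'I_m -> {linear X -> X}),
        (forall j, O (e j)) /\
        forall f, O f <-> exists c : 'I_m -> sring S,
          forall v, f v = \sum_(j < m) Kmul (val (c j)) (e j v)
    & forall f : {linear X -> X}, exists m (e : 'I_m -> {linear X -> X}) (c : 'I_m -> K),
        (forall j, O (e j)) /\ forall v, f v = \sum_(j < m) Kmul (c j) (e j v)].

Definition is_maximal_order (O : {linear X -> X} -> Prop) : Prop :=
  is_order O /\
  forall O', is_order O' -> (forall f, O f -> O' f) -> forall f, O' f -> O f.

Variable V : submodClosed (restr TG_incl X).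

(* End_{TG}(V) as a subring of End_{LG}(X): every endomorphism of V extends
   uniquely to X once V spans X over K. *)
Definition End_lattice (f : {linear X -> X}) : Prop :=
  exists f' : {linear submodule V -> submodule V},
    forall v : submodule V, val (f' v) = f (val v).

Definition admissible_lattice : Prop :=
  [/\ finitely_generated (submodule V),
      forall x : X, exists m (c : 'I_m -> K) (v : 'I_m -> X),
        (forall j, v j \in V) /\ x = \sum_(j < m) Kmul (c j) (v j)
    & is_maximal_order End_lattice].
End Module.

(* the trace of multiplication by x *)
Definition ext_trace (x : L) : K :=
  \sum_(i < \dim {:L}) coord (vbasis {:L}) i (x * (vbasis {:L})`_i).

Section Bases.
Variable y ystar : 'I_(\dim {:L}) -> L.

Definition is_integral_basis : Prop :=
  [/\ forall l, y l \in intclos L S,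
      forall x, x \in intclos L S -> exists c : 'I_(\dim {:L}) -> sring S,
        x = \sum_l val (c l) *: y l
    & forall c : 'I_(\dim {:L}) -> sring S,
        \sum_l val (c l) *: y l = 0 -> forall l, c l = 0].

Definition is_trace_dual : Prop :=
  basis_of {:L} (codom ystar) /\
  forall l m, ext_trace (y l * ystar m) = (l == m)%:R.

(* pi^t generates the ideal of the z in S with z * ystar l in T for all l *)
Definition is_dual_exponent (pi : sring S) (t : nat) : Prop :=
  forall z : sring S, (exists c, z = c * pi ^+ t) <->
    (forall l, val z *: ystar l \in intclos L S).
End Bases.
End Lattices.

(* Main.v *)
(* The Casimir operator v |-> sum_(s, l) lam(v s^-1 ystar_l) (w y_l s) of a K-linear
   form lam on X_i and a vector w is L G-linear, hence a scalar c, as End X_i = K.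
   Since sum_l y_l ystar_l = 1, taking traces gives x_i c = g lam(w).
   If w lies in V_i but not in pi V_i, then V_i being S-free there is a form lam,
   integral on V_i, such that lam(w) is a unit; the valuation hypothesis makes
   pi^t c a unit as well, and since pi^t ystar_l lies in T, every v in V_i is an
   element of w (T G). So every vector outside pi V_i generates V_i. *)
Require Import Defs.
From HB Require Import structures.
From mathcomp Require Import all_boot all_order all_algebra all_fingroup all_field.
From mathcomp Require Import boolp classical_sets constructive_ereal.

Set Implicit Arguments.
Unset Strict Implicit.
Unset Printing Implicit Defensive.
Import GRing.Theory.
Local Open Scope ring_scope.

(** * Factorization into units and prime powers in a discrete valuation ring *)

Section DiscreteValuation.
Variables (K : fieldType) (S : subringClosed K) (pi : sring S).
Hypothesis dvr : is_dvr pi.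

Lemma sring_unit_inv (u v : sring S) : u * v = 1 -> (val u)^-1 = val v.
Proof. by move=> /(congr1 val); rewrite rmorphM rmorph1 => /mulr1_eq. Qed.

Lemma dvr_prime_neq0 : val pi != 0.
Proof. by have [_ _ p0 _] := dvr; apply: contra_neq p0 => ?; apply: val_inj. Qed.

Lemma dvr_unit_or_dvd (a : sring S) :
  (exists b, a * b = 1) \/ (exists b, a = pi * b).
Proof.
have [_ _ _ h] := dvr; have [u|u] := pselect (exists b, a * b = 1); first by left.
by right; apply/h.
Qed.

Lemma dvr_prime_nonunit (b : sring S) : pi * b <> 1.
Proof.
by have [_ _ _ h] := dvr; move=> e; case: (h pi) => _; case; [exists 1; rewrite mulr1|exists b].
Qed.

Lemma sringM_neq0 (a b : sring S) : a != 0 -> b != 0 -> a * b != 0.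
Proof. by rewrite -!(inj_eq val_inj) rmorphM !rmorph0 mulf_eq0 negb_or => -> ->. Qed.

(** The [b] such that [a] divides some [pi ^+ k * b] form an ideal, generated by some [c]. If
    [c = pi * b], then [b] lies in this ideal too, so [b = e * c = e * pi * b] and [pi] would be a
    unit. Hence [c] is a unit. *)
Lemma dvr_dvd_prime_power (a : sring S) : a != 0 -> exists k d, pi ^+ k = a * d.
Proof.
move=> a0; have [_ pid pi0 _] := dvr.
have [] := pid (fun b => exists k d, pi ^+ k * b = a * d).
- by exists 0%N, 0; rewrite !mulr0.
- move=> b c [k [d hb]] [l [e hc]]; exists (k + l)%N, (pi ^+ l * d + pi ^+ k * e).
  by rewrite mulrDr [RHS]mulrDr !(mulrCA a) -hb -hc exprD -mulrA mulrCA -mulrA.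
- move=> b c [k [d hc]]; exists k, (b * d).
  by rewrite mulrCA hc mulrCA.
move=> c hc; have [k [d hcd]] : exists k d, pi ^+ k * c = a * d.
  by apply/hc; exists 1; rewrite mul1r.
have [[b cb]|[b cb]] := dvr_unit_or_dvd c.
  by exists k, (d * b); rewrite mulrA -hcd -mulrA cb mulr1.
have [e be] : exists e, b = e * c.
  by apply/hc; exists k.+1, d; rewrite exprSr -mulrA -cb.
have c0 : c != 0.
  apply: contra_neq a0 => c0; have [f ->] : exists f, a = f * c.
    by apply/hc; exists 0%N, 1; rewrite mul1r mulr1.
  by rewrite c0 mulr0.
have b0 : b != 0 by apply: contra_neq c0 => b0; rewrite cb b0 mulr0.
have : b * (1 - pi * e) == 0.
  by rewrite mulrBr mulr1 mulrA [b * pi]mulrC -cb mulrC -be subrr.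
have [/eqP|n0] := eqVneq (1 - pi * e) 0; last by rewrite (negPf (sringM_neq0 b0 n0)).
by rewrite subr_eq0 eq_sym => /eqP /dvr_prime_nonunit.
Qed.

(** Induction on the exponent of a power of [pi] divisible by [a], removing one factor [pi] from [a]
    at a time. *)
Lemma dvr_sring_factor (a : sring S) : a != 0 ->
  exists j (u v : sring S), u * v = 1 /\ a = u * pi ^+ j.
Proof.
move=> /dvr_dvd_prime_power [k [d]]; elim: k a => [|k IHk] a.
  by rewrite expr0 => e; exists 0%N, a, d; rewrite mulr1.
have [[b ab]|[b ->]] := dvr_unit_or_dvd a; first by exists 0%N, a, b; rewrite mulr1.
rewrite exprS -mulrA => e.
have {}e : pi ^+ k = b * d.
  apply: val_inj; apply: (mulfI dvr_prime_neq0).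
  by rewrite -[LHS]rmorphM -[RHS]rmorphM e.
have [j [u [v [uv ->]]]] := IHk b e.
by exists j.+1, u, v; rewrite exprS mulrCA.
Qed.

Lemma dvr_factor (y : K) : y != 0 ->
  exists (m : int) (u v : sring S), u * v = 1 /\ y = val u * val pi ^ m.
Proof.
have [frac _ _ _] := dvr; have [a [b [b0 ->]]] := frac y.
have [a0|a0] := eqVneq (val a) 0; first by rewrite a0 mul0r eqxx.
have sn0 (s : sring S) : val s != 0 -> s != 0 by apply: contra_neq => ->.
have [i [u [u' [uu' ->]]]] := dvr_sring_factor (sn0 _ a0).
have [j [v [v' [vv' ->]]]] := dvr_sring_factor (sn0 _ b0).
move=> _; exists (i%:Z - j%:Z), (u * v'), (u' * v); split.
  by rewrite mulrACA uu' mul1r mulrC.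
rewrite !rmorphM !rmorphXn expfzDr ?dvr_prime_neq0 // -exprz_inv -!exprnP exprVn.
by rewrite /= -(sring_unit_inv vv') invfM mulrACA.
Qed.

Lemma valuationE (y : K) : y != 0 -> exists (m : int) (u v : sring S),
  [/\ valuation pi y = m%:E%E, u * v = 1 & y = val u * val pi ^ m].
Proof.
move=> y0; rewrite /valuation (negPf y0).
by case: xgetP (dvr_factor y0) => [m _ [u [v [uv e]]] _|h [m /h]//]; exists m, u, v.
Qed.

(** Turns the hypothesis on valuations into an equation in K up to a unit. Finiteness of the
    valuation of [g] gives [g != 0], and the equality of valuations then gives [x != 0]. *)
Lemma valuation_eq_add (x g : K) (t : nat) :
    (valuation pi g < +oo)%E -> valuation pi x = (valuation pi g + (t%:Z)%:E)%E ->
  x != 0 /\ exists u v : sring S, u * v = 1 /\ val pi ^+ t * g = val u * x.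
Proof.
have [->|g0] := eqVneq g 0; first by rewrite /valuation eqxx.
have [n [u [v [-> uv gE]]]] := valuationE g0 => _.
have [->|x0] := eqVneq x 0; first by rewrite /valuation eqxx.
have [m [a [b [-> ab xE]]]] := valuationE x0 => -[mE].
split=> //; exists (u * b), (v * a); split.
  by rewrite mulrACA uv mul1r mulrC.
have ba : val b * val a = 1 by rewrite -rmorphM mulrC ab rmorph1.
rewrite xE gE rmorphM -(mulrA (val u)) (mulrA (val b)) ba mul1r mE mulrCA.
by rewrite addrC expfzDr ?dvr_prime_neq0.
Qed.

End DiscreteValuation.


(** * Coordinate forms of a basis *)

Section Coordinates.
Variables (K : fieldType) (M : lmodType K) (I : finType) (e : I -> M).

Definition lin_indep (A : {set I}) : Prop :=
  forall c : I -> K, \sum_(i in A) c i *: e i = 0 -> forall i, i \in A -> c i = 0.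

Lemma coordinate_forms (A : {set I}) :
    lin_indep A -> (forall v, exists c : I -> K, v = \sum_(i in A) c i *: e i) ->
  exists f : I -> {scalar M},
    (forall v, v = \sum_(i in A) f i v *: e i) /\
    (forall (c : I -> K) i, i \in A -> f i (\sum_(i in A) c i *: e i) = c i).
Proof.
move=> indep /choice[f fE].
have f_uniq v c : v = \sum_(i in A) c i *: e i -> {in A, f v =1 c}.
  move=> vE i iA; apply/eqP; rewrite -subr_eq0; apply/eqP.
  apply: (indep (fun i => f v i - c i)) iA.
  by under eq_bigr do rewrite scalerBl; rewrite sumrB -fE -vE subrr.
(* Off [A] the chosen coefficients are arbitrary, so the form is set to 0 there to be linear for
   every [i]. *)
have scal i : exists g : {scalar M}, forall v, g v = if i \in A then f v i else 0.
  have lin : scalar (fun v => if i \in A then f v i else 0).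
    move=> a u v; case: ifP => iA; last by rewrite mulr0 addr0.
    apply: (f_uniq _ (fun i => a * f u i + f v i)) (iA).
    rewrite {1}[u]fE {1}[v]fE scaler_sumr -big_split; apply: eq_bigr => j _.
    by rewrite scalerA scalerDl.
  pose gi v := if i \in A then f v i else 0.
  by exists (HB.pack_for {scalar M} gi (GRing.isLinear.Build K M K *%R gi lin)).
have [g gE] := choice scal; exists g; split=> [v|c i iA].
  by rewrite {1}[v]fE; apply: eq_bigr => i iA; rewrite gE iA.
by rewrite gE iA; apply: f_uniq iA.
Qed.

End Coordinates.

(** * Freeness of finitely generated lattices *)

Section LatticeBasis.
Variables (K : fieldType) (S : subringClosed K) (pi : sring S).
Hypothesis dvr : is_dvr pi.
Variables (M : lmodType K) (I : finType) (e : I -> M).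

(** The index [k] has least valuation among the nonzero coefficients. The quantifier on [s] stands
    outside the membership test so that [choice] yields a function on all of [I]. *)
Lemma dvr_min_index (A : {set I}) (c : I -> K) j : j \in A -> c j != 0 ->
  exists2 k, k \in A /\ c k != 0 & forall i, exists s : sring S, i \in A -> c i = val s * c k.
Proof.
move=> jA cj0.
have h i : exists z : int * (sring S * sring S), c i != 0 ->
    z.2.1 * z.2.2 = 1 /\ c i = val z.2.1 * val pi ^ z.1.
  have [->|ci0] := eqVneq (c i) 0; first by exists (0, (0, 0)); rewrite ?eqxx.
  by have [m [u [v uv]]] := dvr_factor dvr ci0; exists (m, (u, v)).
have [z zE] := choice h.
pose P i := (i \in A) && (c i != 0).
have Pj : P j by rewrite /P jA.
case: (@Order.TotalTheory.arg_minP _ _ _ j P (fun i => (z i).1) Pj) => k /andP[kA ck0] kmin.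
exists k => // i; have [ci0|ci0] := eqVneq (c i) 0; first by exists 0; rewrite ci0 mul0r.
have [iA|iA] := boolP (i \in A); last by exists 0.
have /kmin := introT andP (conj iA ci0).
rewrite -Num.Theory.subr_ge0; case ed: (_ - _) => [d|//] _.
have [_ ->] := zE i ci0; have [uv ->] := zE k ck0.
exists ((z i).2.1 * (z k).2.2 * pi ^+ d) => _.
have uv1 : val (z k).2.2 * val (z k).2.1 = 1 by rewrite mulrC -rmorphM uv rmorph1.
have -> : val ((z i).2.1 * (z k).2.2 * pi ^+ d) =
    val (z i).2.1 * val (z k).2.2 * val pi ^ d by rewrite !rmorphM rmorphXn.
rewrite [RHS]mulrACA -(mulrA (val (z i).2.1)) uv1 mulr1 -ed.
by rewrite -expfzDr ?(dvr_prime_neq0 dvr) // subrK.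
Qed.

Definition sring_span (A : {set I}) (v : M) : Prop :=
  exists c : I -> sring S, v = \sum_(i in A) val (c i) *: e i.

(** A minimal generating subset is independent over K: dividing a relation by its coefficient of
    least valuation expresses one generator through the others with coefficients in S. *)
Lemma sring_span_basis : exists A : {set I},
  (forall v, sring_span [set: I]%SET v <-> sring_span A v) /\ lin_indep e A.
Proof.
pose P A := `[< forall v, sring_span [set: I]%SET v <-> sring_span A v >].
have PT : P [set: I]%SET by apply/asboolP.
have [A /minsetP[/asboolP PA minA]] := @ex_minset _ P (ex_intro (fun A => is_true (P A)) _ PT).
exists A; split=> // c c0 j jA; apply/eqP/negPn/negP => cj0.
have [k [kA ck0] /choice[s sE]] := dvr_min_index jA cj0.
suff /minA/(_ (finset.subD1set A k)) AE : P (A :\ k)%SET.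
  by move: kA; rewrite -AE finset.setD11.
have splitk (F : I -> M) :
    \sum_(i in A) F i = F k + \sum_(i in (A :\ k)%SET) F i.
  rewrite (bigD1 k) //=; congr (_ + _).
  by apply: eq_bigl => i; rewrite !inE andbC.
apply/asboolP => v; rewrite PA; split=> -[d ->]; last first.
  exists (fun i => if i == k then 0 else d i).
  rewrite splitk eqxx rmorph0 scale0r add0r.
  by apply: eq_bigr => i; rewrite !inE => /andP[/negPf->].
have ekE : e k = - \sum_(i in (A :\ k)%SET) val (s i) *: e i.
  apply: (scalerI ck0); apply/eqP.
  rewrite scalerN scaler_sumr -addr_eq0 -[X in _ == X]c0 splitk.
  apply/eqP; congr (_ + _); apply: eq_bigr => i; rewrite !inE => /andP[_ iA].
  by rewrite scalerA mulrC -sE.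
exists (fun i => d i - d k * s i).
rewrite splitk ekE scalerN scaler_sumr addrC -sumrB; apply: eq_bigr => i _.
by rewrite rmorphB rmorphM scalerBl scalerA.
Qed.

End LatticeBasis.


(** * Dual bases for the trace form *)

Section TraceForm.
Variables (K : fieldType) (L : fieldExtType K).

Fact ext_trace_scalar : scalar (@ext_trace K L).
Proof.
move=> a u v; rewrite /ext_trace mulr_sumr -big_split; apply: eq_bigr => i _.
by rewrite mulrDl -scalerAl linearP.
Qed.
HB.instance Definition _ := GRing.isLinear.Build K L K *%R (@ext_trace K L) ext_trace_scalar.

Variables y ystar : 'I_(\dim {:L}) -> L.
Hypothesis dual : is_trace_dual y ystar.

Lemma trace_dual_expand z : z = \sum_l ext_trace (y l * z) *: ystar l.
Proof.
have [/span_basis ystar_span dualE] := dual.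
have : z \in <<codom ystar>>%VS by rewrite ystar_span memvf.
rewrite span_def big_map big_enum => /memv_sumP[u uE zE].
have /choice[c cE] i : exists c, u i = c *: ystar i by apply/vlineP/uE.
rewrite [LHS]zE; apply: eq_bigr => l _; rewrite cE; congr (_ *: _).
rewrite zE mulr_sumr linear_sum (bigD1 l) //= big1 => [|m /negPf lm].
  by rewrite cE -scalerAr linearZ /= dualE eqxx mulr1 addr0.
by rewrite cE -scalerAr linearZ /= dualE eq_sym lm mulr0.
Qed.

Lemma trace_nondegenerate z : (forall l, ext_trace (z * y l) = 0) -> z = 0.
Proof.
move=> z0; rewrite [z]trace_dual_expand big1 // => l _.
by rewrite mulrC z0 scale0r.
Qed.

(** The defect [d] pairs to 0 with every [ystar m], hence with every [y l], as the [ystar m] span L;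
    nondegeneracy then makes it vanish. *)
Lemma trace_primal_expand z : z = \sum_l ext_trace (z * ystar l) *: y l.
Proof.
have [_ dualE] := dual.
apply/eqP; rewrite -subr_eq0; apply/eqP; set d := _ - _.
have d0 m : ext_trace (d * ystar m) = 0.
  rewrite mulrBl linearB mulr_suml linear_sum (bigD1 m) //= big1 => [|l lm].
    by rewrite -scalerAl linearZ /= dualE eqxx mulr1 addr0 subrr.
  by rewrite -scalerAl linearZ /= dualE (negPf lm) mulr0.
apply: trace_nondegenerate => l; rewrite [y l]trace_dual_expand.
rewrite mulr_sumr linear_sum big1 // => m _.
by rewrite -scalerAr linearZ /= d0 mulr0.
Qed.

(** The right side is the matrix trace of multiplication by [z] in the basis [y]. The change of
    basis expands [vbasis] in [y], swaps the sums, and reassembles [z * y l] from [vbasis]. *)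
Lemma ext_trace_dual z : ext_trace z = \sum_l ext_trace (z * y l * ystar l).
Proof.
rewrite {1}/ext_trace.
under eq_bigr => i _.
  rewrite [X in z * X]trace_primal_expand mulr_sumr linear_sum.
  under eq_bigr => l _ do rewrite -scalerAr linearZ /=.
over.
rewrite exchange_big; apply: eq_bigr => l _ /=.
rewrite [X in _ = ext_trace (X * _)](coord_vbasis (memvf _)) mulr_suml linear_sum.
by apply: eq_bigr => i _; rewrite -scalerAl linearZ /= mulrC.
Qed.

(** Paired with [y m], both sides give the trace of [y m], by [ext_trace_dual]. *)
Lemma sum_trace_dual : \sum_l y l * ystar l = 1.
Proof.
apply/eqP; rewrite -subr_eq0; apply/eqP.
apply: trace_nondegenerate => m.
rewrite mulrBl mul1r linearB /= (ext_trace_dual (y m)) mulr_suml linear_sum -sumrB.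
by apply: big1 => l _; rewrite mulrC mulrA subrr.
Qed.

(* The element sum_l ystar_l (x) y_l of L (x)_K L is killed by z (x) 1 - 1 (x) z. *)
Lemma trace_dual_casimir (M : lmodType K) (f : {scalar L}) (h : {linear L -> M}) z :
  \sum_l f (z * ystar l) *: h (y l) = \sum_l f (ystar l) *: h (z * y l).
Proof.
(* The matrix of multiplication by [z] in the basis [ystar] is the transpose of its matrix in the
   basis [y]. *)
transitivity (\sum_l \sum_m f (ystar m) *: h (ext_trace (y m * (z * ystar l)) *: y l)).
  apply: eq_bigr => l _; rewrite {1}[z * _]trace_dual_expand linear_sum scaler_suml.
  by apply: eq_bigr => m _; rewrite !linearZ /= scalerA mulrC.
rewrite exchange_big; apply: eq_bigr => m _ /=.
rewrite -scaler_sumr -linear_sum; congr (_ *: h _).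
rewrite [RHS]trace_primal_expand; apply: eq_bigr => l _.
by rewrite mulrA (mulrC z).
Qed.

End TraceForm.

(** * Modules over the twisted group ring as K-spaces *)

Section RestrictScalars.
Variables (gT : finGroupType) (K : fieldType) (L : fieldExtType K).
Variables (act : galoisAction gT L) (X : rmodType (twg act)).

(** An alias of [X] whose [*:] is the action of K, kept apart from the action of the twisted group
    ring on [X]. *)
Definition Kspace : Type := X.
HB.instance Definition _ := GRing.Zmodule.on Kspace.

Definition rmul (s : gT) (z : L) (v : Kspace) : Kspace :=
  (twg_mono act s z : (twg act)^c) *: (v : X).

Lemma rmulM s t y z v : rmul t z (rmul s y v) = rmul (s * t)%g (act y t * z) v.
Proof. by rewrite /rmul scalerA -twg_monoM. Qed.

Lemma rmul1 v : rmul 1%g 1 v = v.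
Proof. exact: scale1r. Qed.

Lemma rmulDr s z : {morph rmul s z : u v / u + v}.
Proof. by move=> u v; rewrite /rmul scalerDr. Qed.

Lemma rmulDl s v : {morph (rmul s)^~ v : y z / y + z}.
Proof.
move=> y z; rewrite /rmul -scalerDl; congr (_ *: _); apply: twgP => t.
by rewrite tcoefD !tcoef_mono; case: eqP => _; rewrite ?addr0.
Qed.

Fact Kspace_scaleA a b (v : Kspace) : rmul 1%g a%:A (rmul 1%g b%:A v) = rmul 1%g (a * b)%:A v.
Proof. by rewrite rmulM act_id mulg1 mulr_algl scalerA mulrC. Qed.
Fact Kspace_scale1 v : rmul 1%g 1%:A v = v.
Proof. by rewrite scale1r rmul1. Qed.
Fact Kspace_scaleDr : right_distributive (fun c : K => rmul 1%g c%:A) +%R.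
Proof. by move=> c u v; exact: rmulDr. Qed.
Fact Kspace_scaleDl v : {morph (fun c : K => rmul 1%g c%:A v) : a b / a + b}.
Proof. by move=> a b; rewrite scalerDl rmulDl. Qed.
HB.instance Definition _ := GRing.Zmodule_isLmodule.Build K Kspace
  Kspace_scaleA Kspace_scale1 Kspace_scaleDr Kspace_scaleDl.

Lemma KmulE c (v : Kspace) : Kmul c v = c *: v.
Proof. by []. Qed.

Lemma rmulZl s a z v : rmul s (a *: z) v = a *: rmul s z v.
Proof. by rewrite [RHS]rmulM mulg1 act_id mulrC mulr_algl. Qed.

Lemma rmul0 s v : rmul s 0 v = 0.
Proof. by rewrite -(scale0r (0 : L)) rmulZl scale0r. Qed.

Fact rmul_linear s z : linear (rmul s z).
Proof.
move=> a u v; rewrite rmulDr; congr (_ + _).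
by rewrite -rmulZl [LHS]rmulM mul1g gact_alg mulr_algl.
Qed.
HB.instance Definition _ s z :=
  GRing.isLinear.Build K Kspace Kspace _ (rmul s z) (rmul_linear s z).

(** A function of [z], packaged as a K-linear map so that [trace_dual_casimir] applies to it. *)
Definition lmulr (s t : gT) (v : Kspace) (z : L) : Kspace := rmul s (act z t) v.
Fact lmulr_linear s t v : linear (lmulr s t v).
Proof.
by move=> a y z; rewrite /lmulr ractD -mulr_algl ractM gact_alg mulr_algl rmulDl rmulZl.
Qed.
HB.instance Definition _ s t v :=
  GRing.isLinear.Build K L Kspace _ (lmulr s t v) (lmulr_linear s t v).

Lemma scale_rmul (a : (twg act)^c) (v : Kspace) : a *: (v : X) = \sum_s rmul s (tcoef (a : twg act) s) v.
Proof. by rewrite {1}[a]twg_monoE scaler_suml. Qed.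

End RestrictScalars.

(** * The Casimir operator and its trace *)

Section Casimir.
Variables (gT : finGroupType) (K : fieldType) (L : fieldExtType K).
Variables (act : galoisAction gT L) (X : rmodType (twg act)).
Variables y ystar : 'I_(\dim {:L}) -> L.
Hypothesis dual : is_trace_dual y ystar.
Variables (f : {scalar Kspace X}) (w : Kspace X).

(** The vector [rmul s (act (y l) s) w] is w y_l s, because y s = s y^s in the twisted group
    ring. *)
Definition casimir (v : Kspace X) : Kspace X :=
  \sum_s \sum_l f (rmul s^-1%g (ystar l) v) *: rmul s (act (y l) s) w.

Lemma casimirD : {morph casimir : u v / u + v}.
Proof.
move=> u v; rewrite /casimir -big_split; apply: eq_bigr => s _.
rewrite -big_split; apply: eq_bigr => l _.
by rewrite rmulDr linearD scalerDl.
Qed.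

(** Reindexing the sum over G absorbs [t]; the factor [z], carried back by the inverse group
    element, is moved from [ystar] to [y] by [trace_dual_casimir]. *)
Lemma casimir_rmul t z v : casimir (rmul t z v) = rmul t z (casimir v).
Proof.
rewrite /casimir linear_sum (reindex_inj (mulIg t)); apply: eq_bigr => r _ /=.
rewrite linear_sum.
pose g (z : L) := f (lmulr r^-1%g 1%g v z).
have g_lin : scalar g by move=> a u u'; rewrite /g !linearP.
pose fg := HB.pack_for {scalar L} g (GRing.isLinear.Build K L K *%R g g_lin).
transitivity (\sum_l fg (act z (r * t)^-1%g * ystar l) *: lmulr (r * t)%g (r * t)%g w (y l)).
  apply: eq_bigr => l _; congr (f _ *: _).
  by rewrite rmulM /lmulr act_id invMg mulKVg.
rewrite (trace_dual_casimir dual); apply: eq_bigr => l _.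
rewrite linearZ /= /fg /= /g /lmulr act_id rmulM ractM -!act_mul mulVg act_id.
by rewrite mulrC.
Qed.

Lemma casimir_linear : linear (casimir : X -> X).
Proof.
move=> a u v; rewrite [LHS]casimirD; congr (_ + _).
have casimir0 : casimir 0 = 0 by apply: (addrI (casimir 0)); rewrite -casimirD !addr0.
rewrite !scale_rmul (big_morph casimir casimirD casimir0).
by apply: eq_bigr => s _; rewrite casimir_rmul.
Qed.

Hypothesis EndK : End_is_K X.

Lemma casimir_scalar : exists c : K, forall v, casimir v = c *: v.
Proof.
by have [c cE] := EndK (HB.pack_for {linear X -> X} (casimir : X -> X)
  (GRing.isLinear.Build _ _ _ _ (casimir : X -> X) casimir_linear)); exists c.
Qed.

(** The trace of the operator is computed twice: as that of a scalar, and as a sum of traces of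
    operators v |-> lam(v) u, each equal to lam(u). *)
Lemma casimir_trace (d : nat) (b : 'I_d -> Kspace X) (c : K) :
  lin_indep b [set: _] -> (forall v, exists a : 'I_d -> K, v = \sum_i a i *: b i) ->
  (forall v, casimir v = c *: v) -> d%:R * c = #|gT|%:R * f w.
Proof.
move=> b_indep b_span cE.
have {}b_span v : exists a : 'I_d -> K, v = \sum_(i in [set: 'I_d]) a i *: b i.
  by have [a ->] := b_span v; exists a; apply: eq_bigl => i; rewrite inE.
have [e [eE e_coord]] := coordinate_forms b_indep b_span.
have {}eE v : v = \sum_i e i v *: b i.
  by rewrite {1}[v]eE; apply: eq_bigl => i; rewrite inE.
have eb i : e i (b i) = 1.
  have bE : b i = \sum_(j in [set: 'I_d]) (j == i)%:R *: b j.
    rewrite (bigD1 i) ?inE // eqxx scale1r big1 /= ?addr0 // => j /andP[_ /negPf->].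
    exact: scale0r.
  by rewrite bE (e_coord (fun j => (j == i)%:R)) ?inE // eqxx.
transitivity (\sum_i e i (casimir (b i))).
  rewrite (eq_bigr (fun=> c)) => [|i _]; last by rewrite cE linearZ /= eb mulr1.
  by rewrite sumr_const card_ord mulr_natl.
transitivity (\sum_s \sum_l f (rmul s^-1%g (ystar l) (rmul s (act (y l) s) w))).
  pose u s l := rmul s (act (y l) s) w.
  transitivity (\sum_i \sum_s \sum_l f (rmul s^-1%g (ystar l) (b i)) * e i (u s l)).
    apply: eq_bigr => i _; rewrite /casimir linear_sum; apply: eq_bigr => s _.
    by rewrite linear_sum; apply: eq_bigr => l _; rewrite linearZ.
  rewrite exchange_big; apply: eq_bigr => s _ /=.
  rewrite exchange_big; apply: eq_bigr => l _ /=.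
  rewrite -/(u s l) [X in _ = f (_ X)]eE !linear_sum; apply: eq_bigr => i _.
  by rewrite !linearZ /= mulrC.
transitivity (\sum_(s : gT) f w); last by rewrite sumr_const mulr_natl.
apply: eq_bigr => s _; rewrite -linear_sum; congr (f _).
(* The elements s and s^-1 cancel, leaving [w] times the sum of the y_l ystar_l, which is 1. *)
transitivity (\sum_l rmul 1%g (y l * ystar l) w).
  by apply: eq_bigr => l _; rewrite rmulM -act_mul mulgV act_id.
by rewrite -(big_morph _ (rmulDl 1%g w) (rmul0 _ _)) (sum_trace_dual dual) rmul1.
Qed.

End Casimir.


(** * Dimension over K when the endomorphism ring is K *)

Section EndomorphismField.
Variables (gT : finGroupType) (K : fieldType) (L : fieldExtType K).
Variables (act : galoisAction gT L) (X : rmodType (twg act)).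

(** G fixes K, so [c%:A] is central in the twisted group ring and [pmulZ] applies. *)
Lemma Kmul_linear (c : K) : linear (@Kmul gT K L act X c).
Proof.
move=> a u v; rewrite /Kmul [LHS]scalerDr; congr (_ + _).
exact: esym (pmulZ (gact_alg act c) a u).
Qed.

Lemma dim_over_End_basis d : End_is_K X -> simple_module X -> dim_over_End X d ->
  exists b : 'I_d -> Kspace X, lin_indep b [set: 'I_d]%SET /\
    forall v, exists a : 'I_d -> K, v = \sum_i a i *: b i.
Proof.
move=> EndK [[v0 v0n0] _] [b [b_span b_indep]]; exists b; split=> [c c0 i _|v].
  pose F j := HB.pack_for {linear X -> X} (@Kmul gT K L act X (c j))
    (GRing.isLinear.Build _ X X _ _ (Kmul_linear (c j))).
  (* Independence over End(X) makes [F i] vanish everywhere; evaluating at the nonzero vector [v0]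
     supplied by simplicity forces [c i = 0]. *)
  have F0 : F i v0 = 0.
    apply: (b_indep F); rewrite -[RHS]c0.
    by apply: eq_bigl => j; rewrite inE.
  apply/eqP/negPn/negP => ci0; apply: v0n0.
  apply: (@scalerI K (Kspace X) (c i) ci0).
  by rewrite scaler0; exact: F0.
have [F vE] := b_span v; have /choice[a aE] i := EndK (F i).
by exists a; rewrite {1}vE; apply: eq_bigr => i _; exact: aE.
Qed.

End EndomorphismField.

(** * S-bases of lattices over the twisted group ring of T *)

Section Lattice.
Variables (gT : finGroupType) (K : fieldType) (L : fieldExtType K).
Variables (act : galoisAction gT L) (S : subringClosed K) (pi : sring S).
Hypothesis dvr : is_dvr pi.
Variables (X : rmodType (twg act)).

Local Notation XT := (restr (@TG_incl gT K L act S) X).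

Lemma scale_TG (a : (twg (tact act S))^c) (v : XT) :
  a *: v = \sum_s rmul s (val (tcoef (a : twg (tact act S)) s)) (v : Kspace X).
Proof.
rewrite [LHS](scale_rmul (TG_incl (a : twg (tact act S)))).
by apply: eq_bigr => s _; rewrite tcoef_map.
Qed.

Lemma scale_TG_mono s (z : tring L S) (v : XT) :
  (twg_mono (tact act S) s z : (twg (tact act S))^c) *: v = rmul s (val z) (v : Kspace X).
Proof.
rewrite scale_TG (bigD1 s) //= big1 => [|t /negPf ts].
  by rewrite tcoef_mono eqxx addr0.
by rewrite tcoef_mono ts rmul0.
Qed.

Variables (V : submodClosed XT).

Lemma lattice_rmul s z (v : XT) : z \in intclos L S -> v \in V ->
  (rmul s z (v : Kspace X) : XT) \in V.
Proof.
move=> zT vV.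
rewrite -(scale_TG_mono s (Sub z zT)).
by rewrite rpredZ.
Qed.

Lemma lattice_scale (c : sring S) (v : Kspace X) :
  (v : XT) \in V -> (val c *: v : XT) \in V.
Proof. exact: (lattice_rmul _ (sring_intclos L c)). Qed.

Variable y : 'I_(\dim {:L}) -> L.
Hypothesis y_basis : is_integral_basis S y.
Hypothesis V_adm : admissible_lattice V.

Lemma lattice_basis : exists (I : finType) (e : I -> Kspace X) (A : {set I}),
  [/\ lin_indep e A,
      forall v : Kspace X, (v : XT) \in V <-> sring_span S e A v
    & forall v, exists a : I -> K, v = \sum_(i in A) a i *: e i].
Proof.
have [[m [e0 e0_gen]] V_span _] := V_adm; have [yT y_span _] := y_basis.
(* Module generators of V times the S-basis s y_l of the twisted group ring of T generate V over
   S. *)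
pose I : finType := ('I_m * gT * 'I_(\dim {:L}))%type.
pose e (i : I) : Kspace X := rmul i.1.2 (y i.2) (val (e0 i.1.1) : XT).
have [A [spanA indepA]] := sring_span_basis dvr e.
have VE (v : Kspace X) : (v : XT) \in V <-> sring_span S e A v.
  rewrite -spanA; split=> [vV|[c ->]]; last first.
    apply: rpred_sum => i _; apply: lattice_scale; apply: lattice_rmul => //.
    exact: valP.
  have [a aE] := e0_gen (Sub (v : XT) vV).
  have /choice[c cE] (js : 'I_m * gT) := y_span _ (valP (tcoef (a js.1 : twg (tact act S)) js.2)).
  exists (fun i => c i.1 i.2).
  transitivity (\sum_js \sum_l val (c js l) *: e (js, l)); last first.
    by rewrite pair_bigA; apply: eq_big => i; rewrite ?inE.
  have -> : v = \sum_j a j *: (val (e0 j) : XT).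
    have /(congr1 val) := aE; rewrite SubK linear_sum => ->.
    by apply: eq_bigr => j _; rewrite linearZ.
  transitivity (\sum_j \sum_s \sum_l val (c (j, s) l) *: e (j, s, l)); last first.
    by rewrite pair_bigA; apply: eq_bigr => -[].
  apply: eq_bigr => j _; rewrite scale_TG; apply: eq_bigr => s _.
  rewrite (cE (j, s)).
  rewrite (big_morph _ (rmulDl s (val (e0 j) : Kspace X)) (rmul0 _ _)).
  by apply: eq_bigr => l _; rewrite rmulZl.
exists I, e, A; split=> // v.
(* Spanning over K follows from KV = X by expanding vectors of V. *)
have [n [c [u [uV ->]]]] := V_span v.
have /choice[d dE] j : exists d : I -> sring S, u j = \sum_(i in A) val (d i) *: e i.
  exact: (VE (u j)).1 (uV j).
exists (fun i => \sum_j c j * val (d j i)).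
under eq_bigr => j _ do rewrite KmulE dE scaler_sumr.
rewrite exchange_big; apply: eq_bigr => i _; rewrite scaler_suml.
by apply: eq_bigr => j _; rewrite scalerA.
Qed.
End Lattice.


(** * Vectors outside pi times a lattice *)

Section UnitCoordinate.
Variables (K : fieldType) (S : subringClosed K) (pi : sring S).
Hypothesis dvr : is_dvr pi.
Variables (M : lmodType K) (I : finType) (e : I -> M) (A : {set I}).

(** If no coordinate were a unit, [pi] would divide each of them and could be factored out of the
    vector. *)
Lemma sring_span_unit_coef (c : I -> sring S) :
    ~ (exists2 u, sring_span S e A u & \sum_(i in A) val (c i) *: e i = val pi *: u) ->
  exists2 i, i \in A & exists b, c i * b = 1.
Proof.
move=> w_npi; apply: contrapT => no_unit; apply: w_npi.
have h i : exists d, i \in A -> c i = pi * d.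
  have [iA|_] := boolP (i \in A); last by exists 0.
  have [u|[d cE]] := dvr_unit_or_dvd dvr (c i); last by exists d.
  by case: no_unit; exists i.
have [d cE] := choice h.
exists (\sum_(i in A) val (d i) *: e i); first by exists d.
rewrite scaler_sumr; apply: eq_bigr => i iA.
by rewrite cE // rmorphM scalerA.
Qed.

End UnitCoordinate.

(** * Cyclic generation and simplicity of the reduction *)

Section CyclicLattice.
Variables (gT : finGroupType) (K : fieldType) (L : fieldExtType K).
Variables (act : galoisAction gT L) (S : subringClosed K) (pi : sring S).
Hypothesis dvr : is_dvr pi.
Variables (X : rmodType (twg act)).
Local Notation XT := (restr (@TG_incl gT K L act S) X).
Variables (V : submodClosed XT).
Variables y ystar : 'I_(\dim {:L}) -> L.
Hypothesis y_basis : is_integral_basis S y.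
Hypothesis y_dual : is_trace_dual y ystar.
Hypothesis V_adm : admissible_lattice V.

(** This makes the reduction nonzero. As [X] is nonzero there is a basis vector, and its coordinate
    1 is not divisible by [pi]. *)
Lemma lattice_neq_prime_multiple : simple_module X ->
  exists2 w : Kspace X, (w : XT) \in V &
    ~ exists2 u : Kspace X, (u : XT) \in V & w = val pi *: u.
Proof.
move=> [[m m0] _]; have [I [e [A [indepA VE spanA]]]] := lattice_basis dvr y_basis V_adm.
have [i iA] : exists i, i \in A.
  apply: contrapT => A0; apply: m0; have [a mE] := spanA m; rewrite [LHS]mE.
  by rewrite big1 // => i iA; case: A0; exists i.
have [f [_ f_coord]] := coordinate_forms indepA spanA.
have eiE : e i = \sum_(j in A) val ((j == i)%:R : sring S) *: e j.
  rewrite (bigD1 i) // eqxx rmorph1 scale1r big1 /= ?addr0 // => j /andP[_ /negPf->].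
  exact: scale0r.
exists (e i); first by apply/VE; exists (fun j => (j == i)%:R).
move=> [u /VE[c uE] eE]; apply: (dvr_prime_nonunit dvr (b := c i)).
apply: val_inj; rewrite rmorphM rmorph1.
have fu : f i u = val (c i) by rewrite uE (f_coord (fun j => val (c j))).
transitivity (f i (val pi *: u)); first by rewrite linearZ /= fu.
rewrite -eE eiE (f_coord (fun j => val ((j == i)%:R : sring S))) //.
by rewrite eqxx rmorph1.
Qed.

Variables (d t : nat).
Hypothesis X_simple : simple_module X.
Hypothesis X_End : End_is_K X.
Hypothesis X_dim : dim_over_End X d.
Hypothesis t_exp : is_dual_exponent ystar pi t.
Hypothesis d_neq0 : d%:R != 0 :> K.
Hypothesis d_val : exists u v : sring S,
  u * v = 1 /\ val pi ^+ t * #|gT|%:R = val u * d%:R.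

Lemma lattice_cyclic (w v : Kspace X) :
    (w : XT) \in V -> ~ (exists2 u : Kspace X, (u : XT) \in V & w = val pi *: u) ->
    (v : XT) \in V ->
  exists a : twg (tact act S), (v : XT) = (a : (twg (tact act S))^c) *: (w : XT).
Proof.
move=> wV w_npi vV.
have [I [e [A [indepA VE spanA]]]] := lattice_basis dvr y_basis V_adm.
have [f [_ f_coord]] := coordinate_forms indepA spanA.
have [c wE] := (VE w).1 wV.
(* The form lam is the coordinate [f i] at an index where [w] has a unit coefficient, with inverse
   [b]. *)
have [|i iA [b cb]] := sring_span_unit_coef dvr (c := c) (e := e) (A := A).
  by move=> [u /VE uV wu]; apply: w_npi; exists u => //; rewrite wE.
have f_int u : (u : XT) \in V -> exists s : sring S, f i u = val s.
  by move=> /VE[s ->]; exists (s i); rewrite (f_coord (fun j => val (s j))).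
have [ka kaE] := casimir_scalar y_dual (f i) w X_End.
have [bas [bas_indep bas_span]] := dim_over_End_basis X_End X_simple X_dim.
have := casimir_trace y_dual bas_indep bas_span kaE.
rewrite [X in f i X]wE (f_coord (fun j => val (c j))) // => trE.
have [u [u' [uu' uE]]] := d_val.
(* Multiply the trace formula by pi^t, replace pi^t g by a unit times [d], and cancel [d]. *)
have kaU : val pi ^+ t * ka = val u * val (c i).
  apply: (mulfI d_neq0); rewrite mulrCA trE mulrA uE.
  by rewrite -mulrA mulrCA.
have inv_ka : val (u' * b) * val pi ^+ t * ka = 1.
  by rewrite -mulrA kaU -!rmorphM mulrACA [u' * u]mulrC uu' [b * _]mulrC cb mulr1 rmorph1.
have ystarT l : val pi ^+ t *: ystar l \in intclos L S.
  have := (t_exp (pi ^+ t)).1 _ l; rewrite rmorphXn; apply.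
  by exists 1; rewrite mul1r.
have h (sl : gT * 'I_(\dim {:L})) : exists r : sring S,
    f i (rmul sl.1^-1%g (val pi ^+ t *: ystar sl.2) v) = val r.
  by apply: f_int; apply: lattice_rmul.
have [r rE] := choice h.
have [yT _ _] := y_basis.
(* Read off from v = (u' b) pi^t casimir(v), with pi^t moved onto the [ystar l] so that lam takes
   the values [r] in S. *)
pose a s : tring L S :=
  \sum_l sring_tring L (u' * b * r (s, l)) * tact act S (Sub (y l) (yT l)) s.
exists (mk_twg (tact act S) a).
rewrite scale_TG -[LHS](scale1r (v : Kspace X)) -inv_ka -scalerA -kaE /casimir.
rewrite scaler_sumr; apply: eq_bigr => s _.
rewrite tcoef_mk /a rmorph_sum (big_morph _ (rmulDl s w) (rmul0 _ _)).
rewrite scaler_sumr; apply: eq_bigr => l _.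
rewrite rmorphM /= /sring_in mulr_algl rmulZl scalerA.
have -> : val (u' * b * r (s, l)) = val (u' * b) * val (r (s, l)) by rewrite rmorphM.
by rewrite -(rE (s, l)) rmulZl linearZ /= mulrA.
Qed.

Local Notation rp := (@rproj _ _ _ _ (sring_fixed act pi) (submodule V)).

(** A nonzero submodule [U] contains a nonzero class; its representative lies outside pi V, hence
    generates V by [lattice_cyclic], and so [U] is everything. *)
Lemma reduction_simple :
  simple_module (reduction (sring_fixed act pi) (submodule V)).
Proof.
have piE (u : submodule V) : val (pmul (sring_tring L pi) u) = (val pi *: (val u : Kspace X) : XT).
  by rewrite /pmul linearZ; exact: scale_TG_mono.
have npi (w : submodule V) : rp w <> 0 ->
    ~ (exists2 u : Kspace X, (u : XT) \in V & (val w : Kspace X) = val pi *: u).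
  move=> w0 [u uV wu]; apply: w0.
  rewrite -(raddf0 rp); apply/rprojP.
  by exists (Sub (u : XT) uV); apply: val_inj; rewrite subr0 piE.
split.
  have [w wV w_npi] := lattice_neq_prime_multiple X_simple.
  exists (rp (Sub (w : XT) wV)).
  rewrite -(raddf0 rp) => /rprojP[u].
  rewrite subr0 => /(congr1 val); rewrite piE => wu.
  by apply: w_npi; exists (val u : XT) => //; exact: valP.
move=> U; have [U0|/existsNP[m]] := pselect (forall m, m \in U -> m = 0); first by left.
move=> /not_implyP[mU m0]; right=> v.
rewrite -[v]rreprK; have := m0; rewrite -{1}[m]rreprK => /npi/lattice_cyclic.
move=> /(_ (val (rrepr v)) (valP _) (valP _)) [a aE].
have -> : rrepr v = (a : (twg (tact act S))^c) *: rrepr m.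
  by apply: val_inj; rewrite aE linearZ.
by rewrite -red_scaleE rreprK; apply: rpredZ.
Qed.
End CyclicLattice.

Theorem corollary3p1
  (gT : finGroupType) (K : fieldType) (L : fieldExtType K)
  (act : galoisAction gT L)
  (hN : (#|act_kernel act|%:R : K) != 0)
  (k : nat) (X : 'I_k.+1 -> rmodType (twg act))
  (X_simple : forall i, simple_module (X i))
  (X_inj : forall i j, module_iso (X i) (X j) -> i = j)
  (X_surj : forall M : rmodType (twg act), simple_module M ->
      exists i, module_iso M (X i))
  (x : 'I_k.+1 -> nat)
  (hx : forall i, dim_over_End (X i) (x i))
  (S : subringClosed K) (pi : sring S) (hS : is_dvr pi)
  (V : forall i, submodClosed (restr (@TG_incl gT K L act S) (X i)))
  (hV : forall i, admissible_lattice (V i))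
  (phi : {linear X ord0 -> natural_module act}) (phi_bij : bijective phi)
  (hV1 : forall v, (v \in V ord0) = (phi v \in intclos L S))
  (y ystar : 'I_(\dim {:L}) -> L)
  (hy : is_integral_basis S y) (hystar : is_trace_dual y ystar)
  (t : nat) (ht : is_dual_exponent ystar pi t)
  (i : 'I_k.+1)
  (hKi : End_is_K (X i))
  (g_fin : (valuation pi #|gT|%:R < +oo)%E)
  (hxi : valuation pi (x i)%:R = (valuation pi #|gT|%:R + (t%:Z)%:E)%E) :
  simple_module
    (reduction (sring_fixed act pi) (submodule (V i))).
Proof.
have [x_neq0 x_val] := valuation_eq_add hS g_fin hxi.
exact: (reduction_simple hS hy hystar (hV i) (X_simple i) hKi (hx i) ht).
Qed.
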